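(* There exist a countable Markov map $T$ with inverse branches $(f_i)_{i\in\mathbb N}$ and a sequence of countable Markov maps $T_k$, $k\in\mathbb N$, with inverse branches $(f_{i,k})_{i\in\mathbb N}$ of the same orientation as $T$, such that (0) $-\log|T'|$ has summable variations; (1) there exists $0<t<1$ with $\sum_{i=1}^\infty|f_i[0,1]|^t<\infty$; (2) $\sup_{k\in\mathbb N}\sum_{n=1}^\infty\mathrm{var}_n(-\log|T_k'|)<\infty$; (3) for every $i\in\mathbb N$, $f_{i,k}\to f_i$ pointwise on $[0,1]$ as $k\to\infty$; and such that, if $\mu$ is the absolutely continuous $T$-invariant probability measure and $\theta_k$ is the topological conjugacy between $T_k$ and $T$, then $$\lim_{k\to\infty}\dim_{\mathrm H}(\mu\circ\theta_k)=0 .$$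
   Context: A countable Markov map $T:[0,1]\to[0,1]$ is given by inverse branches $f_i:[0,1]\to[0,1]$, $i\in\mathbb N=\{1,2,\dots\}$, which are $C^1$ and strictly monotone, and satisfy one of the following two conditions (the orientation): - decreasing case: all $f_i$ are strictly decreasing, $f_1(0)=1$, $f_{i+1}(0)=f_i(1)$ for all $i$, and $f_i(0)$ decreases to $0$ as $i\to\infty$; - increasing case: all $f_i$ are strictly increasing, $f_1(1)=1$, $f_{i+1}(1)=f_i(0)$ for all $i$, and $f_i(1)$ decreases to $0$ as $i\to\infty$. Moreover there exist $m\in\mathbb N$ and $\xi<1$ (depending on $T$) with $|(f_{i_1}\circ\cdots\circ f_{i_m})'(x)|\le\xi$ for all $(i_1,\dots,i_m)\in\mathbb N^m$ and $x\in(0,1)$. The map is $T(x)=f_i^{-1}(x)$ for $x\in f_i([0,1))$ and $T(0)=0$ (and $T(1)=1$ in the increasing case). $|f_i[0,1]|$ is the length of the interval $f_i([0,1])$. Let $\Sigma=\mathbb N^{\mathbb N}$ with left shift $\sigma$, let $[\mathbf i]\subset\Sigma$ be the cylinder of sequences starting with the finite word $\mathbf i$, and let $\pi_T(i_1,i_2,\dots)=\lim_{n\to\infty}f_{i_1}\circ\cdots\circ f_{i_n}(0)$. The potential $-\log|T'|$ is regarded as the function on $\Sigma$ given by $\phi(\mathbf i)=-\log|T'(\pi_T(\mathbf i))|=\log|f_{i_1}'(\pi_T(\sigma\mathbf i))|$ (assumed finite). For $n\ge1$, $\mathrm{var}_n(\phi)=\sup_{\mathbf i\in\mathbb N^n}\sup\{|\phi(\mathbf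 j)-\phi(\mathbf k)|:\mathbf j,\mathbf k\in[\mathbf i]\}$, and $\phi$ has summable variations if $\sum_{n\ge1}\mathrm{var}_n(\phi)<\infty$. The topological conjugacy $\theta_k$ between $T_k$ and $T$ is the increasing homeomorphism of $[0,1]$ with $T\circ\theta_k=\theta_k\circ T_k$ that matches codings: $\theta_k\circ\pi_{T_k}=\pi_T$ on $\Sigma$, equivalently $\theta_k\circ f_{i,k}=f_i\circ\theta_k$ for all $i$. The measure $\mu\circ\theta_k$ is $A\mapsto\mu(\theta_k(A))$. The Hausdorff dimension of a Radon measure $\nu$ on $\mathbb R$ is $\dim_{\mathrm H}\nu=\inf\{\dim_{\mathrm H}A:\nu(A)>0\}$ (over Borel sets $A$). *)

(* Defs.v *)
From HB Require Import structures.
From mathcomp Require Import all_boot all_order all_algebra.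
From mathcomp Require Import all_classical all_reals all_analysis.

Set Implicit Arguments.
Unset Strict Implicit.
Unset Printing Implicit Defensive.

Import Order.TTheory GRing.Theory Num.Theory.
Import numFieldNormedType.Exports.

Local Open Scope classical_set_scope.
Local Open Scope ring_scope.

(* Functions on the unit interval are functions on R of which only the values
   on [0, 1] matter. Digits and sequence indices start at 0 instead of 1: the
   branch f_i is [f i.-1]. *)

Section Derivative01.
Context {R : realType}.
Implicit Types (f : R -> R) (x : R).

(* The derivative of f as a function on [0, 1], hence one-sided at 0 and 1. *)
Definition slope01 f x : set_system R :=
  (f y - f x) / (y - x) @[y --> within `[0, 1] x^'].

Definition deriv01 f x : R := lim (slope01 f x).

Definition C1_01 f : Prop :=
  (forall x, x \in `[0, 1] -> cvg (slope01 f x)) /\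
  {within `[0, 1], continuous (deriv01 f)}.

End Derivative01.

Section MarkovMap.
Context {R : realType}.
Implicit Types (f : nat -> R -> R) (T : R -> R).

Inductive orientation := Decreasing | Increasing.

Definition oriented_branches (o : orientation) f : Prop :=
  match o with
  | Decreasing =>
      [/\ forall i, {in `[0, 1] &, {homo f i : x y /~ x < y}},
          f 0%N 0 = 1,
          forall i, f i.+1 0 = f i 1,
          nonincreasing_seq (fun i => f i 0) &
          f i 0 @[i --> \oo] --> (0 : R)]
  | Increasing =>
      [/\ forall i, {in `[0, 1] &, {homo f i : x y / x < y}},
          f 0%N 1 = 1,
          forall i, f i.+1 1 = f i 0,
          nonincreasing_seq (fun i => f i 1) &
          f i 1 @[i --> \oo] --> (0 : R)]
  end.

Definition comp_word f (w : seq nat) : R -> R :=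
  foldr (fun i g => f i \o g) idfun w.

Definition uniformly_contracting f : Prop :=
  exists (m : nat) (xi : R), [/\ (0 < m)%N, xi < 1 &
    forall (w : m.-tuple nat) (x : R), x \in `]0, 1[ ->
      `|derive1 (comp_word f w) x| <= xi].

Record inverse_branches (o : orientation) f : Prop := InverseBranches {
  branch_range : forall i, set_fun `[0, 1] `[0, 1] (f i) ;
  branch_C1 : forall i, C1_01 (f i) ;
  branch_oriented : oriented_branches o f ;
  branch_contracting : uniformly_contracting f }.

(* The values of T outside [0, 1] are arbitrary. *)
Record countable_markov_map (o : orientation) f T : Prop :=
  CountableMarkovMap {
  markov_branches : inverse_branches o f ;
  markov_inverse : forall i x, x \in `[0, 1[ -> T (f i x) = x ;
  markov_at0 : T 0 = 0 ;
  markov_at1 : o = Increasing -> T 1 = 1 }.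

Definition coding f (s : nat -> nat) : R :=
  lim (comp_word f (mkseq s n) 0 @[n --> \oo]).

Definition left_shift (s : nat -> nat) : nat -> nat := fun n => s n.+1.

(* The potential - log |T'| on sequences, in terms of the branches. *)
Definition potential f (s : nat -> nat) : R :=
  ln `|deriv01 (f (s 0%N)) (coding f (left_shift s))|.

(* [ln 0 = 0] in the library, so that the finiteness of the potential has to
   be stated separately. *)
Definition finite_potential f : Prop :=
  forall s : nat -> nat, deriv01 (f (s 0%N)) (coding f (left_shift s)) != 0.

Definition cylinder (w : seq nat) : set (nat -> nat) :=
  [set s | mkseq s (size w) = w].

Definition var_ (phi : (nat -> nat) -> R) (n : nat) : \bar R :=
  ereal_sup [set ereal_sup
      [set (`|phi p.1 - phi p.2|)%:E | p in cylinder w `*` cylinder w]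
    | w in [set: n.-tuple nat]].

Definition sum_variations (phi : (nat -> nat) -> R) : \bar R :=
  (\sum_(1 <= n <oo) var_ phi n)%E.

Definition summable_variations (phi : (nat -> nat) -> R) : Prop :=
  (sum_variations phi < +oo)%E.

Definition increasing_homeo01 (theta : R -> R) : Prop :=
  [/\ {in `[0, 1] &, {homo theta : x y / x < y}},
      set_fun `[0, 1] `[0, 1] theta,
      {within `[0, 1], continuous theta} &
      exists g : R -> R,
        [/\ set_fun `[0, 1] `[0, 1] g, {within `[0, 1], continuous g},
            {in `[0, 1], cancel theta g} & {in `[0, 1], cancel g theta}]].

(* theta is the conjugacy between the map T' with branches f' and the map T
   with branches f. *)
Definition conjugacy f' T' f T (theta : R -> R) : Prop :=
  [/\ increasing_homeo01 theta,
      forall x, x \in `[0, 1] -> T (theta x) = theta (T' x) &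
      forall s, theta (coding f' s) = coding f s].

(* Absolutely continuous T-invariant probability measures on [0, 1], as Borel
   measures on R giving mass 1 to [0, 1]. *)
Definition acip T (mu : probability (measurableTypeR R) R) : Prop :=
  [/\ mu `[0%R, 1%R]%classic = 1%E,
      mu `<< lebesgue_measure &
      forall A : set (measurableTypeR R), measurable A ->
        mu (`[0%R, 1%R]%classic `&` T @^-1` A) = mu A].

End MarkovMap.

Section HausdorffDimension.
Context {R : realType}.
Local Open Scope ereal_scope.

Definition diam (U : set R) : \bar R :=
  ereal_sup [set (`|p.1 - p.2|)%:E | p in U `*` U].

(* |U|^s, where the empty set counts 0 even for s = 0. *)
Definition diam_pow (s : R) (U : set R) : \bar R :=
  if U == set0 then 0 else diam U `^ s.

Definition hausdorff_premeasure (s delta : R) (A : set R) : \bar R :=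
  ereal_inf [set \sum_(i <oo) diam_pow s (U i) |
    U in [set U : nat -> set R |
      A `<=` \bigcup_i U i /\ forall i, diam (U i) <= delta%:E]].

Definition hausdorff_measure (s : R) (A : set R) : \bar R :=
  ereal_sup [set hausdorff_premeasure s delta A |
    delta in [set delta : R | (0 < delta)%R]].

Definition hausdorff_dim (A : set R) : \bar R :=
  ereal_inf [set s%:E |
    s in [set s : R | (0 <= s)%R /\ hausdorff_measure s A = 0]].

Definition hausdorff_dim_measure (nu : set R -> \bar R) : \bar R :=
  ereal_inf [set hausdorff_dim A |
    A in [set A : set R |
      measurable (A : set (measurableTypeR R)) /\ 0 < nu A]].

(* The measure mu \o theta on [0, 1], extended by 0 to R. *)
Definition comp_measure01 (mu : set R -> \bar R) (theta : R -> R) :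
  set R -> \bar R := fun A => mu (theta @` (A `&` `[0%R, 1%R])).

End HausdorffDimension.

(* Main.v *)
(* The maps are piecewise affine and increasing, with branch i mapping [0, 1]
   onto [2^-e(i+1), 2^-e(i)] for a strictly increasing e with e 0 = 0. All
   variations then vanish, Lebesgue measure on [0, 1] is invariant, and coding
   is a bijection of N^N onto ]0, 1] which is monotone for an order that does
   not depend on e, so that matching codings yields the conjugacies.

   T is given by e = id and T_k by an e that agrees with id up to k and grows
   super-exponentially afterwards. For Lebesgue almost every point, for all
   large m some digit among the first 4^m is >= m: the exceptional set has
   measure (1 - 2^-m)^(4^m) <= 2^-m, and Borel-Cantelli applies. For T_k the
   points with such a digit are covered by at most (m + 1)^(4^m) intervals of
   length at most 2^-e(m), since a word followed by all digits >= m codes a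
   single interval. As e(m) is huge, mu o theta_k charges a set of dimension 0,
   and its dimension is 0 for every k. *)
Require Import Defs.
From HB Require Import structures.
From mathcomp Require Import all_boot all_order all_algebra.
From mathcomp Require Import all_classical all_reals all_analysis.
From mathcomp Require Import measurable_realfun lra.
Import Order.TTheory GRing.Theory Num.Theory.
Import numFieldNormedType.Exports.
Set Implicit Arguments.
Unset Strict Implicit.
Unset Printing Implicit Defensive.
Local Open Scope classical_set_scope.
Local Open Scope ring_scope.

(** * Piecewise affine maps *)

Record admissible (e : nat -> nat) : Prop := Admissible {
  adm0 : e 0%N = 0%N ;
  admS : forall i, (e i < e i.+1)%N }.

Section LinearBranches.
Context {R : realType}.
Implicit Types (e : nat -> nat) (s : nat -> nat) (x y : R).

Definition endpoint e (i : nat) : R := 2^-1 ^+ e i.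

Definition len e (i : nat) : R := endpoint e i - endpoint e i.+1.

(** The length of branch 0, as [endpoint e 0] is 1 for admissible [e]; it serves as the common
    contraction ratio. *)
Definition max_len e : R := 1 - endpoint e 1.

Definition branch e (i : nat) (x : R) : R := endpoint e i.+1 + len e i * x.

(* The points 0 and 1 are not of the form [branch e i y] with [y < 1], so they
   take the default value and are fixed. *)
Definition linear_map e (x : R) : R :=
  xget x [set y | 0 <= y < 1 /\ exists i, branch e i y = x].

Context {e : nat -> nat} (he : admissible e).

Lemma adm_homo : {homo e : i j / (i < j)%N}.
Proof. by apply: homo_ltn; [exact: ltn_trans|exact: (admS he)]. Qed.

Lemma adm_ge i : (i <= e i)%N.
Proof. by elim: i => // i ih; exact: leq_ltn_trans ih (admS he i). Qed.

Lemma endpoint_gt0 i : 0 < endpoint e i :> R.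
Proof. by rewrite exprn_gt0. Qed.

Lemma endpoint0 : endpoint e 0 = 1.
Proof. by rewrite /endpoint (adm0 he). Qed.

Lemma endpoint_ltr i j : (i < j)%N -> endpoint e j < endpoint e i.
Proof.
by move=> /adm_homo ij; rewrite /endpoint ltr_iXn2l// ?invr_gt0// invf_lt1// ltr1n.
Qed.

Lemma endpoint_ler i j : (i <= j)%N -> endpoint e j <= endpoint e i.
Proof. by rewrite leq_eqVlt => /predU1P[->//|/endpoint_ltr/ltW]. Qed.

Lemma endpoint_le1 i : endpoint e i <= 1.
Proof. by rewrite -endpoint0; exact: endpoint_ler. Qed.

Lemma endpoint_le_exp i : endpoint e i <= 2^-1 ^+ i.
Proof. by apply: ler_wiXn2l; rewrite ?adm_ge// ?invr_ge0// invf_le1// ler1n. Qed.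

Lemma endpoint_cvg0 : endpoint e i @[i --> \oo] --> (0 : R).
Proof.
apply: (@squeeze_cvgr _ _ _ _ (fun=> 0) (geometric 1 2^-1)).
- by apply: nearW => i /=; rewrite mul1r (ltW (endpoint_gt0 i)) endpoint_le_exp.
- exact: cvg_cst.
- by apply: cvg_geometric; rewrite ger0_norm// invf_lt1// ltr1n.
Qed.

Lemma len_gt0 i : 0 < len e i :> R.
Proof. by rewrite subr_gt0 endpoint_ltr. Qed.

Lemma len_sum n : \sum_(0 <= i < n) len e i = 1 - endpoint e n :> R.
Proof.
elim: n => [|n ih]; first by rewrite big_geq// endpoint0// subrr.
by rewrite big_nat_recr//= ih /len; lra.
Qed.

Lemma max_len_lt1 : max_len e < 1.
Proof. by rewrite ltrBlDr ltrDl endpoint_gt0. Qed.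

Lemma max_len_gt0 : 0 < max_len e.
Proof. by have := len_gt0 0; rewrite /len endpoint0. Qed.

(** Every branch of index at least 1 has its image below [endpoint e 1 <= 1/2], while branch 0
    occupies the remaining length, at least 1/2. *)
Lemma len_max i : len e i <= max_len e.
Proof.
rewrite /len /max_len; case: i => [|i]; first by rewrite endpoint0.
have h1 : endpoint e i.+1 <= endpoint e 1 by exact: endpoint_ler.
have h2 : endpoint e 1 <= 2^-1 ^+ 1 by exact: endpoint_le_exp.
have h3 := endpoint_gt0 i.+2.
by rewrite expr1 in h2; lra.
Qed.

Lemma branch0 i : branch e i 0 = endpoint e i.+1.
Proof. by rewrite /branch mulr0 addr0. Qed.

Lemma branch1 i : branch e i 1 = endpoint e i.
Proof. by rewrite /branch mulr1 addrC subrK. Qed.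

Lemma branch_ltr i x y : (branch e i x < branch e i y) = (x < y).
Proof. by rewrite /branch ltrD2l ltr_pM2l// len_gt0. Qed.

Lemma branch_ler i x y : (branch e i x <= branch e i y) = (x <= y).
Proof. by rewrite /branch lerD2l ler_pM2l// len_gt0. Qed.

Lemma branch_inj i : injective (branch e i).
Proof. by move=> x y /eqP; rewrite eq_le !branch_ler -eq_le => /eqP. Qed.

Lemma branchK i : cancel (branch e i) (fun x => (x - endpoint e i.+1) / len e i).
Proof. by move=> x; rewrite /branch addrC addKr mulrC mulKf// gt_eqF// len_gt0. Qed.

Lemma branchVK i : cancel (fun x => (x - endpoint e i.+1) / len e i) (branch e i).
Proof. by move=> x; rewrite /branch mulrC divfK ?gt_eqF ?len_gt0// addrC subrK. Qed.

Lemma branch_ge i x : 0 <= x -> endpoint e i.+1 <= branch e i x.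
Proof. by rewrite -branch0 branch_ler. Qed.

Lemma branch_le i x : x <= 1 -> branch e i x <= endpoint e i.
Proof. by rewrite -branch1 branch_ler. Qed.

Lemma branch_gt0 i x : 0 <= x -> 0 < branch e i x.
Proof. by move=> x0; apply: (lt_le_trans _ (branch_ge i x0)); exact: endpoint_gt0. Qed.

Lemma branch_le1 i x : x <= 1 -> branch e i x <= 1.
Proof. by move=> /(branch_le i)/le_trans; apply; exact: endpoint_le1. Qed.

Lemma branch_uniq_co i j x y : 0 <= x < 1 -> 0 <= y < 1 ->
  branch e i x = branch e j y -> i = j.
Proof.
wlog ij : i j x y / (i <= j)%N => [wl|] /andP[x0 x1] /andP[y0 y1] xy.
  case/orP : (leq_total i j) => ij; first by apply: (wl i j x y) => //; exact/andP.
  by apply/esym; apply: (wl j i y x) => //; exact/andP.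
move: ij; rewrite leq_eqVlt => /predU1P[//|ij].
have := branch_ge i x0; rewrite xy leNgt (lt_le_trans (y := endpoint e j))//.
  by rewrite -branch1 branch_ltr.
exact: endpoint_ler.
Qed.

Lemma branch_lt_index i j x y : (i < j)%N -> y <= 1 -> 0 < x ->
  branch e j y < branch e i x.
Proof.
move=> ij y1 x0; apply: (le_lt_trans (branch_le j y1)).
by apply: (le_lt_trans (endpoint_ler ij)); rewrite -branch0 branch_ltr.
Qed.

Lemma branch_surj x : 0 < x <= 1 -> exists i y, 0 < y <= 1 /\ branch e i y = x.
Proof.
move=> /andP[x0 x1].
have ex : exists i, endpoint e i.+1 < x.
  have /cvgrPdist_lt/(_ x x0)[N _ /(_ N.+1)] := endpoint_cvg0.
  rewrite /= leqnSn => /(_ isT); rewrite sub0r normrN gtr0_norm ?endpoint_gt0//.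
  by exists N.
(* By minimality [x <= endpoint e i] for this index i, so x lies in the image of ]0, 1] under branch
   i. *)
exists (ex_minn ex), ((x - endpoint e (ex_minn ex).+1) / len e (ex_minn ex)).
split; last exact: branchVK.
case: ex_minnP => i ix imin.
rewrite -(branch_ltr i) -(branch_ler i) branchVK branch0 branch1 ix/=.
case: i ix imin => [|i] ix imin; first by rewrite endpoint0.
by rewrite leNgt; apply/negP => /imin; rewrite ltnn.
Qed.

Lemma linear_map_branch i x : 0 <= x < 1 -> linear_map e (branch e i x) = x.
Proof.
move=> x01; rewrite /linear_map; case: xgetP => [y _ [y01 [j yj]]|/(_ x)/= []].
  by have ij := branch_uniq_co y01 x01 yj; apply: (@branch_inj i); rewrite -yj ij.
by split => //; exists i.
Qed.

Lemma linear_map0 : linear_map e 0 = 0.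
Proof.
rewrite /linear_map; case: xgetP => // y _ [/andP[y0 _] [i yi]].
by have := branch_gt0 i y0; rewrite yi ltxx.
Qed.

Lemma linear_map1 : linear_map e 1 = 1.
Proof.
rewrite /linear_map; case: xgetP => // y _ [/andP[_ y1] [i yi]].
have : branch e i y < 1 by rewrite (lt_le_trans _ (endpoint_le1 i))// -branch1 branch_ltr.
by rewrite yi ltxx.
Qed.

End LinearBranches.

(** * Codings *)

Section Coding.
Context {R : realType} {e : nat -> nat} (he : admissible e).
Implicit Types (s t : nat -> nat) (x y : R).

Local Notation f := (@branch R e).

Lemma comp_word_mkseqS (g : nat -> R -> R) s n x :
  comp_word g (mkseq s n.+1) x = g (s 0%N) (comp_word g (mkseq (left_shift s) n) x).
Proof. by rewrite /mkseq /= -[1%N]addn0 iotaDl -map_comp. Qed.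

Lemma comp_word_itv w x : 0 <= x <= 1 -> 0 <= comp_word f w x <= 1.
Proof.
move=> x01; elim: w => //= i w /andP[h0 h1].
by rewrite (ltW (branch_gt0 he _ _))//= branch_le1.
Qed.

Lemma comp_word_mkseq_nd s : nondecreasing_seq (fun n => comp_word f (mkseq s n) 0).
Proof.
apply/nondecreasing_seqP => n; elim: n s => [|n ih] s.
  by have /andP[] := comp_word_itv (mkseq s 1) (x := 0) ltac:(by rewrite lexx ler01).
by rewrite 2!comp_word_mkseqS branch_ler//; exact: ih.
Qed.

Lemma coding_cvg s : comp_word f (mkseq s n) 0 @[n --> \oo] --> coding f s.
Proof.
apply: nondecreasing_is_cvgn; first exact: comp_word_mkseq_nd.
by exists 1 => _ [n _ <-]; have /andP[] := comp_word_itv (mkseq s n) (x := 0)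
  ltac:(by rewrite lexx ler01).
Qed.

Lemma coding_itv01 s : 0 <= coding f s <= 1.
Proof.
have cv := @coding_cvg s.
apply/andP; split; [apply: (limr_ge (cvgP _ cv))|apply: (limr_le (cvgP _ cv))];
  by apply: nearW => n; have /andP[] := comp_word_itv (mkseq s n) (x := 0)
  ltac:(by rewrite lexx ler01).
Qed.

Lemma coding_shift s : coding f s = f (s 0%N) (coding f (left_shift s)).
Proof.
apply: cvg_lim => //; rewrite -(cvg_shiftS (fun n => comp_word f (mkseq s n) 0)).
rewrite (funext (fun n => comp_word_mkseqS f s n 0)).
by apply: cvgD; [exact: cvg_cst|apply: cvgMr; exact: coding_cvg].
Qed.

Lemma coding_gt0 s : 0 < coding f s.
Proof.
by rewrite coding_shift; apply: (branch_gt0 he); have /andP[] := coding_itv01 (left_shift s).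
Qed.

Lemma coding_le1 s : coding f s <= 1.
Proof. by have /andP[] := coding_itv01 s. Qed.

Lemma coding_surj x : 0 < x <= 1 -> exists s, coding f s = x.
Proof.
(* A first digit and a remainder in ]0, 1] are chosen for each point of ]0, 1]; elsewhere the pair
   is arbitrary. Iterating the remainder produces the digits. *)
have /choice[p hp] : forall z : R, exists q : nat * R, 0 < z <= 1 ->
    0 < q.2 <= 1 /\ f q.1 q.2 = z.
  move=> z.
  have [/(branch_surj he)[i [y [h1 h2]]]|_] := boolP (0 < z <= 1).
    by exists (i, y).
  by exists (0%N, 0).
pose S (z : R) := (p z).2; pose s (z : R) n := (p (iter n S z)).1.
have sS z : left_shift (s z) = s (S z).
  by apply/funext => n; rewrite /left_shift /s iterSr.
move=> x01; exists (s x); apply: cvg_lim => //.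
(* Each branch contracts by at most [max_len e], so the word of the first n digits, applied to 0
   instead of the n-th remainder, falls short of x by at most the n-th power of [max_len e]. *)
apply: (squeeze_cvgr (f := fun n => x - geometric 1 (max_len e) n) (h := fun=> x)).
- apply: nearW => n; elim: n x x01 => [|n ih] x /[dup] x01 /andP[x0 x1].
    by rewrite /geometric /= mulr1 subr_le0 x1 ltW.
  rewrite comp_word_mkseqS sS; have [Sx01 Sx] := hp _ x01.
  have /andP[lo up] := ih _ Sx01.
  rewrite -[X in X - _]Sx -[X in _ && (_ <= X)]Sx branch_ler// up andbT.
  apply: (@le_trans _ _ (f (p x).1 (S x - geometric 1 (max_len e) n))); last first.
    by rewrite branch_ler.
  rewrite /branch /geometric /= exprS !mul1r mulrBr addrA lerD2l lerN2.
  by apply: ler_wpM2r; [rewrite exprn_ge0// ltW// max_len_gt0|exact: len_max].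
- rewrite -[X in _ --> X]subr0; apply: cvgB; first exact: cvg_cst.
  by apply: cvg_geometric; rewrite ger0_norm ?max_len_lt1// ltW// max_len_gt0.
- exact: cvg_cst.
Qed.

(** Branches move towards 0 as the index grows, so at the first difference the larger digit gives
    the smaller point, and the common increasing branches before it keep this order. Neighbouring
    images share an endpoint, but the inequality is strict because codings never equal 0. *)
Lemma coding_lex s t n : (forall i, (i < n)%N -> s i = t i) -> (t n < s n)%N ->
  coding f s < coding f t.
Proof.
elim: n s t => [|n ih] s t st lt_n; rewrite (coding_shift s) (coding_shift t).
  by apply: branch_lt_index => //; [exact: coding_le1|exact: coding_gt0].
rewrite st// branch_ltr//; apply: ih => // i i_n; exact: st.
Qed.

End Coding.

Lemma exists_first_difference (s t : nat -> nat) : s <> t ->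
  exists2 n, (forall i, (i < n)%N -> s i = t i) & s n != t n.
Proof.
move=> st; have ex : exists n, s n != t n.
  apply: contrapT => /forallNP h; apply: st; apply/funext => n.
  by apply/eqP/negPn/negP; exact: h.
exists (ex_minn ex); last by case: ex_minnP.
case: ex_minnP => n _ nmin i i_n; apply/eqP/negPn/negP => /nmin.
by rewrite leqNgt i_n.
Qed.

Section CodingOrder.
Context {R : realType} {e e' : nat -> nat} (he : admissible e) (he' : admissible e').
Implicit Types s t : nat -> nat.

Lemma coding_inj : injective (coding (@branch R e)).
Proof.
move=> s t st; apply: contrapT => /exists_first_difference[n eqn].
rewrite neq_ltn => /orP[] lt_n.
  have := coding_lex (R := R) he (fun i h => esym (eqn i h)) lt_n.
  by rewrite st ltxx.
by have := coding_lex (R := R) he eqn lt_n; rewrite st ltxx.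
Qed.

(** For both exponents the order of two codings is decided by the first differing digit in the same
    way. *)
Lemma coding_transfer s t : coding (@branch R e) s < coding (@branch R e) t ->
  coding (@branch R e') s < coding (@branch R e') t.
Proof.
move=> lt_st; have /exists_first_difference[n eqn] : s <> t.
  by move=> st; rewrite st ltxx in lt_st.
rewrite neq_ltn => /orP[] lt_n; last exact: coding_lex eqn lt_n.
have := coding_lex (R := R) he (fun i h => esym (eqn i h)) lt_n.
by move=> /(lt_trans lt_st); rewrite ltxx.
Qed.

End CodingOrder.

(** * The piecewise affine maps are countable Markov maps with vanishing variations *)

Section MarkovLinear.
Context {R : realType}.

(** Properness of this filter makes limits of slopes unique, also at the endpoints, so that
    [deriv01] can be computed. *)
Lemma within01_dnbhs_proper (x : R) : x \in `[0, 1] ->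
  ProperFilter (within `[0, 1] x^').
Proof.
rewrite in_itv /= => /andP[x0 x1]; apply: Build_ProperFilter_ex => P.
rewrite /within /= => /nbhs_ballP[d /= d0 xd].
have r0 : 0 < Num.min (d / 2) (1 / 2) by rewrite lt_min; apply/andP; split; lra.
have rd : Num.min (d / 2) (1 / 2) < d by rewrite gt_min; apply/orP; left; lra.
have r1 : Num.min (d / 2) (1 / 2) <= 1 / 2 by rewrite ge_min lexx orbT.
set r := Num.min _ _ in r0 rd r1.
(* A step r <= 1/2 towards the farther endpoint stays inside [0, 1]. *)
have [xh|xh] := leP x (1 / 2).
  exists (x + r); apply: xd => /=.
  - by rewrite /ball /= opprD addNKr normrN gtr0_norm.
  - by rewrite addrC -subr_eq0 addrK gt_eqF.
  - by rewrite in_itv /=; apply/andP; split; lra.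
exists (x - r); apply: xd => /=.
- by rewrite /ball /= opprB addrCA subrr addr0 gtr0_norm.
- by rewrite addrC -subr_eq0 addrK oppr_eq0 gt_eqF.
- by rewrite in_itv /=; apply/andP; split; lra.
Qed.

Section Affine.
Variables (e : nat -> nat) (i : nat).

Lemma slope01_branch (x : R) : x \in `[0, 1] -> slope01 (branch e i) x --> len e i.
Proof.
move=> x01; apply: cvg_near_cst.
rewrite /slope01; near_simpl.
rewrite /within /=; apply/nbhs_ballP; exists 1 => //= y _ yx _.
by rewrite /branch opprD addrACA subrr add0r -mulrBr mulfK// subr_eq0.
Qed.

Lemma deriv01_branch (x : R) : x \in `[0, 1] -> deriv01 (branch e i) x = len e i.
Proof.
move=> x01; have pf := within01_dnbhs_proper x01.
by apply: cvg_lim => //; exact: slope01_branch.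
Qed.

Lemma derive1_branch (x : R) : derive1 (branch e i) x = len e i.
Proof.
have -> : branch e i = cst (endpoint e i.+1) + len e i *: @id R by apply/funext.
rewrite derive1E deriveD// derive_cst add0r deriveZ//= derive_id.
by rewrite /GRing.scale /= mulr1.
Qed.

Lemma branch_C1_01 : C1_01 (@branch R e i).
Proof.
split; first by move=> x x01; apply/cvg_ex; exists (len e i); exact: slope01_branch.
apply: (@subspace_eq_continuous _ _ _ (fun=> len e i)); last exact: cst_continuous.
by move=> x /set_mem x01; apply/esym/deriv01_branch.
Qed.

End Affine.

Section Markov.
Context {e : nat -> nat} (he : admissible e).

Lemma linear_markov_map : countable_markov_map Increasing (@branch R e) (linear_map e).
Proof.
split.
- split.
  + move=> i x /=; rewrite !in_itv /= => /andP[x0 x1].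
    by rewrite (ltW (branch_gt0 he _ _))//= branch_le1.
  + by move=> i; exact: branch_C1_01.
  + split.
    * by move=> i x y _ _ xy; rewrite branch_ltr.
    * by rewrite branch1 endpoint0.
    * by move=> i; rewrite branch1 branch0.
    * by move=> i j ij; rewrite !branch1; exact: endpoint_ler.
    * by under eq_fun do rewrite branch1; exact: endpoint_cvg0.
  (* Words of length one already contract. *)
  + exists 1%N, (max_len e); split => //; first exact: max_len_lt1.
    move=> [[|i [|//]]]//= w x _.
    change (`|derive1 (branch e i) x| <= max_len e); rewrite derive1_branch.
    by rewrite gtr0_norm ?len_gt0 ?len_max.
- by move=> i x; rewrite in_itv /=; exact: linear_map_branch.
- exact: linear_map0.
- by move=> _; exact: linear_map1.
Qed.

Lemma deriv01_coding i s : deriv01 (branch e i) (coding (@branch R e) s) = len e i.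
Proof. by rewrite deriv01_branch// in_itv /= coding_itv01. Qed.

Lemma linear_finite_potential : finite_potential (@branch R e).
Proof. by move=> s; rewrite deriv01_coding gt_eqF// len_gt0. Qed.

Lemma potential_linear s : potential (@branch R e) s = ln (len e (s 0%N)).
Proof. by rewrite /potential deriv01_coding gtr0_norm// len_gt0. Qed.

(** The potential depends on the first digit only, hence is constant on every cylinder of length at
    least 1, and the sum starts at n = 1. *)
Lemma linear_sum_variations : sum_variations (potential (@branch R e)) = 0%E.
Proof.
rewrite /sum_variations eseries0// => n n1 _; apply/eqP; rewrite eq_le; apply/andP; split.
  apply: ge_ereal_sup => _ [w _ <-]; apply: ge_ereal_sup => _ [[s t] /= [sw tw] <-].
  case: n n1 w sw tw => // n _ w; rewrite /cylinder /= size_tuple => sw tw.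
  by rewrite !potential_linear; move: sw; rewrite -{}tw => -[->]; rewrite subrr normr0.
(* For the lower bound the suprema must be seen to be over nonempty sets; the zero word and the zero
   sequence in its cylinder are witnesses. *)
apply: ereal_sup_ubound => /=; exists [tuple of nseq n 0%N] => //.
apply/eqP; rewrite eq_le; apply/andP; split.
  apply: ge_ereal_sup => _ [[s t] /= [sw tw] <-].
  case: n n1 sw tw => // n _; rewrite /cylinder /= size_nseq => sw tw.
  by rewrite !potential_linear; move: sw; rewrite -{}tw => -[->]; rewrite subrr normr0.
apply: ereal_sup_ubound => /=; exists (fun=> 0%N, fun=> 0%N) => /=.
  by split; rewrite /cylinder /= size_nseq; apply: (@eq_from_nth _ 0%N);
    rewrite ?size_mkseq ?size_nseq// => i i_n; rewrite nth_mkseq// nth_nseq i_n.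
by rewrite subrr normr0.
Qed.

End Markov.
End MarkovLinear.

(** * Conjugacies *)

(* The only point of [0, 1] that is not a coding is 0, sent to the default 0. *)
Definition conj_map {R : realType} (e' e : nat -> nat) (x : R) : R :=
  xget 0 [set y | exists s, coding (branch e') s = x /\ coding (branch e) s = y].

Lemma conj_coding {R : realType} e' e s : admissible e' ->
  conj_map e' e (coding (@branch R e') s) = coding (branch e) s.
Proof.
move=> he'; rewrite /conj_map; case: xgetP => [y _ [t [/(coding_inj he')-> //]]|].
by move=> /(_ (coding (branch e) s))/= []; exists s.
Qed.

Lemma coding_cases {R : realType} e (x : R) : admissible e -> x \in `[0, 1] ->
  x = 0 \/ exists s, coding (branch e) s = x.
Proof.
move=> he; rewrite in_itv /= le_eqVlt => /andP[/predU1P[<-|x0] x1]; [by left|right].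
by apply: (coding_surj he); rewrite x0.
Qed.

Section ConjMap.
Context {R : realType} {e' e : nat -> nat} (he' : admissible e') (he : admissible e).
Implicit Types x y : R.

Lemma conj_map0 : conj_map e' e 0 = 0 :> R.
Proof.
rewrite /conj_map; case: xgetP => // y _ [s [s0 _]].
by have := coding_gt0 (R := R) he' s; rewrite s0 ltxx.
Qed.

Lemma conj_map_itv : set_fun `[0, 1] `[0, 1] (@conj_map R e' e).
Proof.
move=> x /(coding_cases he')[->|[s <-]]; rewrite /= in_itv /=.
  by rewrite conj_map0 lexx ler01.
by rewrite conj_coding// coding_itv01.
Qed.

Lemma conj_map_homo : {in `[0, 1] &, {homo (@conj_map R e' e) : x y / x < y}}.
Proof.
move=> x y /(coding_cases he')[->|[s <-]] /(coding_cases he')[->|[t <-]] xy.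
- by rewrite ltxx in xy.
- by rewrite conj_map0 conj_coding// coding_gt0.
- by have := lt_trans xy (coding_gt0 he' s); rewrite ltxx.
- by rewrite !conj_coding//; exact: coding_transfer xy.
Qed.

End ConjMap.

Lemma conj_mapK {R : realType} e' e : admissible e' -> admissible e ->
  {in `[0, 1], cancel (@conj_map R e' e) (conj_map e e')}.
Proof.
move=> he' he x /(coding_cases he')[->|[s <-]]; first by rewrite !conj_map0.
by rewrite !conj_coding.
Qed.

Section Conjugacy.
Context {R : realType} {e' e : nat -> nat} (he' : admissible e') (he : admissible e).

Lemma conj_map_mono : {in `[0, 1] &, {mono (@conj_map R e' e) : x y / x <= y}}.
Proof. by apply: le_mono_in; exact: conj_map_homo. Qed.

Lemma conj_map1 : conj_map e' e 1 = 1 :> R.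
Proof.
have i1 : (1 : R) \in `[0, 1] by rewrite in_itv /= ler01 lexx.
have gi : conj_map e e' (1 : R) \in `[0, 1] by exact: (conj_map_itv he he').
apply/eqP; rewrite eq_le; apply/andP; split.
  by have := conj_map_itv he' he i1; rewrite /= in_itv /= => /andP[].
rewrite -[leLHS](conj_mapK he he' i1) conj_map_mono//.
by move: gi; rewrite in_itv /= => /andP[].
Qed.

(** A monotone surjection between intervals is continuous; the conjugacy in the other direction
    provides preimages. *)
Lemma conj_map_continuous : {within `[0, 1], continuous (@conj_map R e' e)}.
Proof.
apply: segment_inc_surj_continuous; first exact: conj_map_mono.
rewrite conj_map0// conj_map1 => y y01; exists (conj_map e e' y).
  exact: (conj_map_itv he he').
exact: (conj_mapK he he').
Qed.

End Conjugacy.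

Lemma linear_conjugacy {R : realType} e' e : admissible e' -> admissible e ->
  conjugacy (branch e') (linear_map e') (branch e) (linear_map e) (@conj_map R e' e).
Proof.
move=> he' he; split.
- split; [exact: conj_map_homo|exact: conj_map_itv|exact: conj_map_continuous|].
  exists (conj_map e e'); split; [exact: conj_map_itv|exact: conj_map_continuous| |];
    exact: conj_mapK.
- move=> z /(coding_cases he')[->|[s <-]].
    by rewrite conj_map0// !linear_map0// conj_map0.
  rewrite conj_coding// (coding_shift he') (coding_shift he).
  have := coding_le1 (R := R) he' (left_shift s).
  have := conj_coding (R := R) e (left_shift s) he'.
  have := coding_gt0 (R := R) he' (left_shift s).
  (* The inverse branch formula holds on [0, 1[ only. If the shifted coding is 1, the point is
     [endpoint e' i] with i the first digit: the fixed point 1 when i = 0, and otherwise the image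
     of 0 under the preceding branch, which is mapped to 0. *)
  set x := coding _ (left_shift s) => x0 <-; rewrite le_eqVlt => /predU1P[->|x1].
    rewrite conj_map1// !branch1; case: (s 0%N) => [|i].
      by rewrite !endpoint0// !linear_map1// conj_map1.
    by rewrite -!branch0 !linear_map_branch ?lexx ?ltr01// conj_map0.
  have x01 : x \in `[0, 1] by rewrite in_itv /= !ltW.
  rewrite !linear_map_branch//; first by rewrite (ltW x0).
  have := conj_map_itv he' he x01; rewrite /= in_itv /= => /andP[-> _] /=.
  rewrite -[ltRHS](conj_map1 he' he); apply: conj_map_homo => //.
  by rewrite in_itv /= ler01 lexx.
- by move=> s; exact: conj_coding.
Qed.

(** * The invariant measure *)

(** The pushforward of Lebesgue measure under x -> (x - b) / c, divided by c, gives every half-open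
    interval its length, so it is Lebesgue measure by uniqueness. *)
Lemma lebesgue_measure_affine {R : realType} (b c : R) (A : set (measurableTypeR R)) :
  0 < c -> measurable A ->
  lebesgue_measure ((fun x => (x - b) / c : measurableTypeR R) @^-1` A) =
  (c%:E * lebesgue_measure A)%E.
Proof.
move=> c0 mA.
have cV : 0 <= c^-1 by rewrite invr_ge0 ltW.
pose g (x : measurableTypeR R) : measurableTypeR R := (x - b) / c.
have mg : measurable_fun setT g.
  apply: continuous_measurable_fun => x.
  by apply: cvgMl; apply: cvgB; [exact: cvg_id|exact: cvg_cst].
unshelve epose (nu := (mscale (NngNum cV) (pushforward (@lebesgue_measure R) g) :
  {measure set (measurableTypeR R) -> \bar R})); first exact: mg.
suff -> : lebesgue_measure A = nu A.
  by rewrite /nu /= /mscale /pushforward /= muleA -EFinM divff ?gt_eqF// mul1e.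
apply: lebesgue_measure_unique => // _ [[p q] _ <-].
rewrite /nu /=.
rewrite /mscale /pushforward /=.
rewrite /pushforward.
have -> : g @^-1` `]p, q] = `](c * p + b), (c * q + b)]%classic.
  apply/seteqP; split => x /=; rewrite !in_itv /= -ltrBrDr -lerBlDr ltr_pdivlMr// ler_pdivrMr//;
  by rewrite ![c * _]mulrC.
rewrite !lebesgue_measure_itv /= !lte_fin ltrD2r ltr_pM2l//.
case: ifPn => _; last by rewrite mule0.
by rewrite -!EFinD -EFinM opprD addrACA subrr addr0 -mulrBr mulKf// gt_eqF.
Qed.

Definition unit_lebesgue {R : realType} : set (measurableTypeR R) -> \bar R :=
  mrestr (@lebesgue_measure R) (measurable_itv `[0%R, 1%R]).

HB.instance Definition _ (R : realType) := Measure.on (@unit_lebesgue R).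

Lemma unit_lebesgue_setT {R : realType} : @unit_lebesgue R setT = 1%E.
Proof.
by rewrite /unit_lebesgue /mrestr setTI lebesgue_measure_itv /= lte_fin ltr01 oppr0 adde0.
Qed.

HB.instance Definition _ (R : realType) :=
  Measure_isProbability.Build _ _ _ (@unit_lebesgue R) unit_lebesgue_setT.

Lemma len_series {R : realType} e : admissible e ->
  (\sum_(i <oo) (len e i : R)%:E = 1)%E.
Proof.
move=> he; apply: cvg_lim => //.
under eq_fun do rewrite sumEFin.
apply: cvg_EFin; first exact: nearW.
rewrite (_ : fine \o _ = fun n => 1 - endpoint e n); last by apply/funext => n; exact: len_sum.
rewrite -[X in _ --> X]subr0; apply: cvgB; first exact: cvg_cst.
exact: endpoint_cvg0.
Qed.

(** Discards the points 0 and 1, where the affine map is not given by inverting a branch. *)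
Lemma lebesgue_measureU_endpoints {R : realType} (A F : set (measurableTypeR R)) :
  measurable A -> F `<=` [set 0; 1] ->
  lebesgue_measure (A `|` F) = lebesgue_measure A.
Proof.
move=> mA F01; have cF : countable F.
  by apply: (sub_countable (subset_card_le F01)); exact: finite_set_countable.
by apply: measureU0 => //; [exact: countable_measurable|exact: countable_lebesgue_measure0].
Qed.

(** Up to endpoints, the preimage of A is the disjoint union of the affine copies of A in the branch
    images. Their measures are the measure of A times the branch lengths, which add up to 1. *)
Lemma linear_acip {R : realType} e : admissible e ->
  acip (linear_map e) (@unit_lebesgue R).
Proof.
move=> he; split.
- rewrite -[RHS](unit_lebesgue_setT (R := R)) /=.
  by rewrite /unit_lebesgue /mrestr setTI setIid.
- apply/null_content_dominatesP => A mA A0.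
  apply/eqP; rewrite eq_le measure_ge0 andbT -A0.
  rewrite /= /unit_lebesgue /mrestr; apply: le_measure; rewrite ?inE//.
  exact: measurableI.
move=> A mA; rewrite /= /unit_lebesgue /mrestr.
(* Removing 1 makes the copies in neighbouring branches disjoint. *)
pose B : set (measurableTypeR R) := A `&` `[0, 1[.
have BE x : B x <-> A x /\ 0 <= x < 1 by rewrite /B /= in_itv.
have mB : measurable B by exact: measurableI.
pose g i (x : R) : measurableTypeR R := (x - endpoint e i.+1) / len e i.
have mgB i : measurable ((g i : measurableTypeR R -> measurableTypeR R) @^-1` B).
  rewrite -[X in measurable X]setTI; apply: continuous_measurable_fun => //.
  by move=> x; apply: cvgMl; apply: cvgB; [exact: cvg_id|exact: cvg_cst].
have gE i x : (g i @^-1` B) x <-> exists2 y, B y & branch e i y = x.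
  split=> [Bx|[y By <-]]; first by exists (g i x) => //; exact: branchVK.
  by rewrite /preimage /= /g branchK.
have tg : trivIset setT (fun i => (g i @^-1` B)).
  move=> i j _ _ [x [/gE[y /BE[_ y01] yx] /gE[z /BE[_ z01] zx]]].
  by apply: (branch_uniq_co (R := R) he y01 z01); rewrite yx.
have eqL : `[0%R, 1%R]%classic `&` linear_map e @^-1` A `&` `[0%R, 1%R]%classic =
    (\bigcup_i (g i @^-1` B)) `|`
    ([set 0; 1] `&` (linear_map e @^-1` A)).
  apply/seteqP; split => [x [[x01 Ax] _]|x [[i _ /gE[y By <-]]|[x01 Ax]]].
  - move: x01; rewrite /= in_itv /= => /andP[].
    rewrite le_eqVlt => /predU1P[x0|x0]; first by right; split; [left; rewrite x0|].
    rewrite le_eqVlt => /predU1P[x1|x1]; first by right; split; [right; rewrite x1|].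
    have [|i [y [/andP[y0 y1] yx]]] := branch_surj he (x := x); first by rewrite x0 ltW.
    (* [branch_surj] gives a preimage in ]0, 1]. The value 1 is traded for 0 in the next branch
       image to the right, wait-free of index 0 because x < 1. *)
    have [j [z [z01 zx]]] : exists j z, 0 <= z < 1 /\ branch e j z = x.
      move: y1; rewrite le_eqVlt => /predU1P[y1|y1]; last by exists i, y; rewrite ltW.
      move: yx x1; rewrite y1 branch1; case: i => [|i]; first by rewrite endpoint0// => <-; rewrite ltxx.
      by move=> <- _; exists i, 0; rewrite lexx ltr01 branch0.
    left; exists j => //; apply/gE; exists z => //; apply/BE; split => //.
    by move: Ax; rewrite /preimage /= -zx linear_map_branch.
  - move/BE : By => [Ay /[dup] y01 /andP[y0 y1]].
    have b01 : branch e i y \in `[0, 1].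
      by rewrite in_itv /= (ltW (branch_gt0 he _ _))// branch_le1// ltW.
    by split => //; split => //; rewrite /preimage /= linear_map_branch.
  - by case: x01 Ax => -> Ax; split; try split => //; rewrite /= in_itv /= lexx ler01.
have eqR : A `&` `[0%R, 1%R]%classic = B `|` ([set 1] `&` A).
  apply/seteqP; split => [x [Ax]|x [/BE[Ax /andP[x0 x1]]|[-> A1]]].
  - rewrite /= in_itv /= => /andP[x0]; rewrite le_eqVlt => /predU1P[x1|x1].
      by right; split; [exact: x1|exact: Ax].
    by left; apply/BE; split; [exact: Ax|rewrite x0].
  - by split => //; rewrite /= in_itv /= x0 ltW.
  - by split => //; rewrite /= in_itv /= ler01 lexx.
rewrite eqL eqR [RHS]lebesgue_measureU_endpoints//; last by move=> x [->] _; right.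
rewrite [LHS]lebesgue_measureU_endpoints; [|exact: bigcupT_measurable|by move=> x []].
rewrite measure_bigcup//.
rewrite (eq_eseriesr (fun i _ => lebesgue_measure_affine (endpoint e i.+1) (len_gt0 he i) mB)).
have fB : lebesgue_measure B \is a fin_num.
  rewrite ge0_fin_numE//; apply: (@le_lt_trans _ _ (lebesgue_measure (`[0%R, 1%R] : set R))).
    apply: le_measure; rewrite ?inE// => x [_].
    by rewrite /= !in_itv /= => /andP[-> /ltW].
  by rewrite lebesgue_measure_itv /= lte_fin ltr01 -EFinD ltry.
rewrite -(fineK fB); under eq_eseriesr do rewrite muleC.
rewrite nneseriesZl; last by move=> i _; rewrite lee_fin ltW// len_gt0.
rewrite (_ : (\sum_(i <oo | i \in setT) _)%E = 1%E) ?mule1//.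
rewrite -[RHS](len_series he); apply: eq_eseriesl => i.
by rewrite in_setT.
Qed.

(** * Covers by cylinders *)

Section Covers.
Context {R : realType}.
Implicit Types (l : seq (R * R)) (s : nat -> nat) (e : nat -> nat).

Definition seq_cover l : set R := \big[setU/set0]_(p <- l) `[p.1, p.2]%classic.

Lemma seq_coverP l x : seq_cover l x <-> exists2 p, p \in l & p.1 <= x <= p.2.
Proof.
rewrite /seq_cover -bigcup_seq; split=> [[p pl]|[p pl xp]].
  by rewrite /= in_itv /=; exists p.
by exists p => //=; rewrite in_itv.
Qed.

Lemma seq_cover_measurable l : measurable (seq_cover l : set (measurableTypeR R)).
Proof. by apply: bigsetU_measurable => p _; exact: measurable_itv. Qed.

Lemma lebesgue_measure_seq_cover l : {in l, forall p, p.1 <= p.2} ->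
  (lebesgue_measure (seq_cover l) <= (\sum_(p <- l) (p.2 - p.1))%:E)%E.
Proof.
elim: l => [|p l ih] pl; rewrite /seq_cover ?big_nil ?measure0// !big_cons.
apply: (le_trans (measureU2 _ _ _)); first exact: measurable_itv.
  exact: seq_cover_measurable.
rewrite EFinD; apply: leeD; last by apply: ih => q ql; apply: pl; rewrite inE ql orbT.
rewrite /= lebesgue_measure_itv /=; case: ifPn => // _.
by rewrite lee_fin subr_ge0 pl// mem_head.
Qed.

Definition branch_images e m l : seq (R * R) :=
  [seq (branch e i p.1, branch e i p.2) | i <- iota 0 m, p <- l].

(** Covers the points having a digit at least m among the first n: if the first digit is such, the
    single interval [0, [endpoint e m]] suffices; otherwise one recurses inside the branches of
    index below m. *)
Fixpoint large_digit_cover e m n : seq (R * R) :=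
  if n is n'.+1 then (0, endpoint e m) :: branch_images e m (large_digit_cover e m n')
  else [::].

(** The complementary case: covers the points whose first n digits are all below m. *)
Fixpoint small_digit_cover e m n : seq (R * R) :=
  if n is n'.+1 then branch_images e m (small_digit_cover e m n') else [:: (0, 1)].

Context {e : nat -> nat} (he : admissible e).

Lemma seq_cover_branch_images m l i x : (i < m)%N -> seq_cover l x ->
  seq_cover (branch_images e m l) (branch e i x).
Proof.
move=> im /seq_coverP[p pl xp]; apply/seq_coverP.
exists (branch e i p.1, branch e i p.2); last by rewrite /= !branch_ler.
by apply/allpairsP; exists (i, p); rewrite mem_iota.
Qed.

Lemma large_digit_coverP m n s : (exists2 j, (j < n)%N & (m <= s j)%N) ->
  seq_cover (large_digit_cover e m n) (coding (branch e) s).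
Proof.
elim: n s => [|n ih] s [j jn sj] //=; rewrite (coding_shift he).
have [ms0|s0m] := leqP m (s 0%N).
  apply/seq_coverP; exists (0, endpoint e m); first exact: mem_head.
  rewrite /= (ltW (branch_gt0 he _ _)) /=; last exact: ltW (coding_gt0 he _).
  exact: le_trans (branch_le he _ (coding_le1 he _)) (endpoint_ler he ms0).
have /seq_coverP[p pl xp] : seq_cover (branch_images e m (large_digit_cover e m n))
    (branch e (s 0%N) (coding (branch e) (left_shift s))).
  apply: seq_cover_branch_images => //; apply: ih.
  by case: j jn sj => [|j] jn sj; [rewrite leqNgt s0m in sj|exists j].
by apply/seq_coverP; exists p => //; rewrite inE pl orbT.
Qed.

Lemma small_digit_coverP m n s : (forall j, (j < n)%N -> (s j < m)%N) ->
  seq_cover (small_digit_cover e m n) (coding (branch e) s).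
Proof.
elim: n s => [|n ih] s sm /=.
  by apply/seq_coverP; exists (0, 1); [exact: mem_head|exact: coding_itv01].
rewrite (coding_shift he); apply: seq_cover_branch_images; first exact: sm.
by apply: ih => j jn; exact: sm.
Qed.

Lemma large_digit_cover_size m n : (size (large_digit_cover e m n) <= m.+1 ^ n)%N.
Proof.
elim: n => //= n ih; rewrite size_allpairs size_iota expnS mulSn.
(* With N = (m + 1)^n, this is 1 + m N <= N + m N. *)
by rewrite -add1n leq_add ?expn_gt0// leq_mul2l ih orbT.
Qed.

Lemma len_le1 i : len e i <= 1 :> R.
Proof. exact: le_trans (len_max he _) (ltW max_len_lt1). Qed.

Lemma large_digit_cover_len m n : {in large_digit_cover e m n, forall p,
  p.1 <= p.2 /\ p.2 - p.1 <= endpoint e m}.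
Proof.
elim: n => //= n ih p; rewrite inE => /predU1P[->|].
  by rewrite /= subr0 ltW ?endpoint_gt0.
move=> /allpairsP[[i q] /= [_ /ih[q12 ql] ->]] /=; rewrite branch_ler//; split => //.
apply: le_trans ql; rewrite /branch opprD addrACA subrr add0r -mulrBr.
by rewrite ler_piMl ?len_le1// subr_ge0.
Qed.

Lemma small_digit_cover_le m n : {in small_digit_cover e m n, forall p, p.1 <= p.2}.
Proof.
elim: n => [|n ih] p /=; first by rewrite inE => /eqP ->.
by move=> /allpairsP[[i q] /= [_ /ih q12 ->]] /=; rewrite branch_ler.
Qed.

(** Each level multiplies the total length by the sum of the first m branch lengths, which
    telescopes to [1 - endpoint e m]. *)
Lemma small_digit_cover_sum m n :
  \sum_(p <- small_digit_cover e m n) (p.2 - p.1) = (1 - endpoint e m) ^+ n.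
Proof.
elim: n => [|n ih] /=; first by rewrite big_seq1 subr0 expr0.
rewrite big_allpairs_dep /= exprS -ih.
under eq_bigr => i _.
  under eq_bigr => p _ do rewrite /branch opprD addrACA subrr add0r -mulrBr.
  rewrite -mulr_sumr.
  over.
rewrite -mulr_suml -(len_sum he); congr (_ * _).
by rewrite /index_iota subn0.
Qed.

End Covers.

(** * Hausdorff dimension *)

Section Hausdorff.
Context {R : realType}.
Implicit Types (s delta : R) (A U : set R) (l : seq (R * R)).

Lemma diam_pow_ge0 s U : (0 <= diam_pow s U)%E.
Proof. by rewrite /diam_pow; case: ifP => // _; exact: poweR_ge0. Qed.

Lemma hausdorff_premeasure_ge0 s delta A : (0 <= hausdorff_premeasure s delta A)%E.
Proof.
apply: le_ereal_inf_tmp => _ [U _ <-].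
by apply: nneseries_ge0 => i _ _; exact: diam_pow_ge0.
Qed.

Lemma diam_itv_le (a b c : R) : 0 <= c -> b - a <= c -> (diam `[a, b] <= c%:E)%E.
Proof.
move=> c0 abc; apply: ge_ereal_sup => _ [[x y] /= [xab yab] <-]; move: xab yab.
rewrite !in_itv /= => /andP[ax xb] /andP[ay yb].
by rewrite lee_fin ler_norml; apply/andP; split; lra.
Qed.

Lemma diam_pow_itv_le s (a b c : R) : 0 < s -> 0 <= c -> b - a <= c ->
  (diam_pow s `[a, b] <= (c `^ s)%:E)%E.
Proof.
move=> s0 c0 abc; rewrite /diam_pow; have [_|/set0P[x xab]] := eqVneq (`[a, b]%classic : set R) set0.
  by rewrite lee_fin powR_ge0.
have d0 : (0 <= diam `[a, b])%E.
  by apply: ereal_sup_ubound => /=; exists (x, x) => //=; rewrite subrr normr0.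
rewrite -poweR_EFin; apply: gt0_ler_poweR; first exact: ltW.
- by rewrite in_itv /= d0 leey.
- by rewrite in_itv /= lee_fin c0 leey.
- exact: diam_itv_le.
Qed.

Lemma hausdorff_premeasure_seq_cover s delta A l c : 0 < s -> 0 <= c -> c <= delta ->
  A `<=` seq_cover l -> {in l, forall p, p.2 - p.1 <= c} ->
  (hausdorff_premeasure s delta A <= ((size l)%:R * c `^ s)%:E)%E.
Proof.
move=> s0 c0 c_delta Al lc.
(* The default pair (1, 0) gives the empty interval [1, 0], so the finite cover is continued to a
   sequence at no cost. *)
pose q i := nth (1, 0) l i; pose U i : set R := `[(q i).1, (q i).2]%classic.
have qc i : (q i).2 - (q i).1 <= c.
  have [il|li] := ltnP i (size l); first by apply: lc; exact: mem_nth.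
  by rewrite /q nth_default//= sub0r (le_trans _ c0)// lerN10.
have U0 i : (size l <= i)%N -> U i = set0.
  move=> li; rewrite /U /q nth_default//=; apply/seteqP; split => x //=.
  by rewrite in_itv /= => /andP[/le_trans /[apply]]; rewrite ler10.
apply: ge_ereal_inf; exists (\sum_(i <oo) diam_pow s (U i))%E.
  exists U => //; split => [x /Al/seq_coverP[p pl xp]|i].
    by exists (index p l) => //; rewrite /U /q nth_index//= in_itv.
  by apply: (@le_trans _ _ c%:E); [exact: diam_itv_le|rewrite lee_fin].
rewrite (nneseries_split 0 (size l)); last by move=> i _; exact: diam_pow_ge0.
rewrite eseries0 ?adde0; last first.
  by move=> i li _; rewrite U0// /diam_pow eqxx.
apply: (@le_trans _ _ (\sum_(0 <= i < size l) (c `^ s)%:E)%E).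
  by apply: lee_sum => i _; exact: diam_pow_itv_le.
by rewrite sumEFin lee_fin sumr_const_nat subn0 mulr_natl.
Qed.

Lemma hausdorff_dim_ge0 A : (0 <= hausdorff_dim A)%E.
Proof. by apply: le_ereal_inf_tmp => _ [s [s0 _] <-]; rewrite lee_fin. Qed.

(** The hypothesis makes the s-dimensional measure vanish for each s > 0, so every such s bounds the
    dimension. *)
Lemma hausdorff_dim_eq0 A :
  (forall s delta eps, 0 < s -> 0 < delta -> 0 < eps ->
    (hausdorff_premeasure s delta A <= eps%:E)%E) -> hausdorff_dim A = 0%E.
Proof.
move=> hA; apply/eqP; rewrite eq_le hausdorff_dim_ge0 andbT.
apply/lee_addgt0Pr => s s0; rewrite add0e; apply: ge_ereal_inf.
exists s%:E => //; exists s => //; split; first exact: ltW.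
apply/eqP; rewrite eq_le; apply/andP; split.
  apply: ge_ereal_sup => _ [delta delta0 <-].
  by apply/lee_addgt0Pr => eps eps0; rewrite add0e; exact: hA.
apply: (le_trans (hausdorff_premeasure_ge0 s 1 A)).
by apply: ereal_sup_ubound; exists 1 => //=; exact: ltr01.
Qed.

End Hausdorff.

(** * The exponents of the perturbed maps and the numerical estimates *)

Section Exponents.

(* The number (m + 1)^(4^m) of covering intervals is at most 2^(m * 4^m); the
   outer factor m beats the power s of the lengths as soon as m * s >= 1. *)
Definition fast_exponent (m : nat) : nat := (m * (m * 4 ^ m + m))%N.

Definition truncated_exponent (k i : nat) : nat :=
  if (i <= k)%N then i else fast_exponent i.

Lemma fast_exponent_ge m : (m <= fast_exponent m)%N.
Proof. by case: m => // m; rewrite /fast_exponent leq_pmulr// addn_gt0 orbT. Qed.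

Lemma fast_exponentS m : (fast_exponent m < fast_exponent m.+1)%N.
Proof.
by rewrite /fast_exponent ltn_mul// -addnS leq_add// leq_mul// leq_pexp2l.
Qed.

Lemma admissible_id : admissible id.
Proof. by split. Qed.

Lemma admissible_truncated k : admissible (truncated_exponent k).
Proof.
split => // i; rewrite /truncated_exponent.
have [ik|ki] := leqP i.+1 k; first by rewrite (ltnW ik).
have [ik|_] := leqP i k; last exact: fast_exponentS.
exact: fast_exponent_ge.
Qed.

End Exponents.

Lemma fast_cover_sum {R : realType} (m : nat) (s : R) : 0 < s -> 1 <= m%:R * s ->
  (m.+1 ^ (4 ^ m))%:R * ((2^-1 ^+ fast_exponent m) `^ s) <= 2^-1 ^+ m.
Proof.
move=> s0 ms.
have h0 : (0 : R) <= 2^-1 by rewrite invr_ge0.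
have h1 : (2^-1 : R) <= 1 by rewrite invf_le1// ler1n.
(* The lengths are (2^-Y)^m, so their power s is at most 2^-Y because m s >= 1. The count cancels
   the part m 4^m of Y, and the summand m leaves the factor 2^-m. *)
pose Y := (m * 4 ^ m + m)%N.
have hp : (2^-1 ^+ fast_exponent m) `^ s <= 2^-1 ^+ Y :> R.
  rewrite /fast_exponent -/Y mulnC exprM -powR_mulrn ?exprn_ge0// -powRrM.
  by apply: ge1r_powR => //; rewrite exprn_gt0 ?invr_gt0// exprn_ile1.
have hN : (m.+1 ^ (4 ^ m))%:R <= 2 ^+ (m * 4 ^ m) :> R.
  by rewrite -natrX ler_nat expnM leq_exp2r ?expn_gt0//; exact: ltn_expl.
apply: (le_trans (ler_pM (ler0n _ _) (powR_ge0 _ _) hN hp)).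
by rewrite /Y exprD mulrA -exprMn divff ?expr1n ?mul1r.
Qed.

(** Induction step: (1 - x)(1 + (n + 1) x) = 1 + n x - (n + 1) x^2 <= 1 + n x. *)
Lemma bernoulli_decay {R : realType} (x : R) n : 0 <= x <= 1 ->
  (1 - x) ^+ n * (1 + n%:R * x) <= 1.
Proof.
move=> /andP[x0 x1]; elim: n => [|n ih]; first by rewrite expr0 mul0r addr0 mulr1.
apply: le_trans ih; rewrite exprSr -mulrA; apply: ler_wpM2l.
  by rewrite exprn_ge0// subr_ge0.
rewrite -natr1.
have : 0 <= n%:R * x ^+ 2 :> R by rewrite mulr_ge0// sqr_ge0.
by have := sqr_ge0 x; rewrite !expr2; nra.
Qed.

Lemma no_large_digit_measure {R : realType} m :
  (1 - 2^-1 ^+ m) ^+ (4 ^ m) <= 2^-1 ^+ m :> R.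
Proof.
have x0 : 0 < 2^-1 ^+ m :> R by rewrite exprn_gt0// invr_gt0.
have x1 : 2^-1 ^+ m <= 1 :> R.
  by apply: exprn_ile1; rewrite ?invr_ge0// invf_le1// ler1n.
have := bernoulli_decay (4 ^ m) (x := 2^-1 ^+ m : R) ltac:(by rewrite ltW).
set y := _ ^+ _ in x0 x1 *; set w := (1 - y) ^+ _.
(* As y = 2^-m, the product 4^m y is 2^m, and the Bernoulli bound becomes 1 / (1 + 2^m). *)
have -> : (4 ^ m)%:R * y = y^-1.
  rewrite (_ : 4 = 2 * 2)%N// expnMn natrM -mulrA natrX /y -exprMn divff// expr1n.
  by rewrite mulr1 -exprVn invrK.
have w0 : 0 <= w by rewrite exprn_ge0// subr_ge0.
move=> h; have : w * y^-1 <= 1 by apply: le_trans h; rewrite ler_wpM2l// lerDr.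
by rewrite ler_pdivrMr// mul1r.
Qed.

(** * A set of dimension 0 charged by the transported measure *)

Section DimensionDrop.
Context {R : realType}.

(** Contains every [T_k]-coding that, for each m >= M, has a digit at least m among its first 4^m.
    Intersecting the covers rather than the sets of such points makes measurability immediate. *)
Definition large_digits_from (k M : nat) : set R :=
  \bigcap_(m in [set m | (M <= m)%N])
    seq_cover (large_digit_cover (truncated_exponent k) m (4 ^ m)).

Lemma large_digits_from_measurable k M :
  measurable (large_digits_from k M : set (measurableTypeR R)).
Proof. by apply: bigcap_measurable => [|m _]; [exists M => /=|exact: seq_cover_measurable]. Qed.

Lemma hausdorff_dim_large_digits_from k M : hausdorff_dim (large_digits_from k M) = 0%E.
Proof.
apply: hausdorff_dim_eq0 => s delta eps s0 delta0 eps0.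
have half0 : (2^-1 ^+ m : R) @[m --> \oo] --> 0.
  have -> : (fun m => 2^-1 ^+ m : R) = geometric 1 2^-1 by apply/funext => m /=; rewrite mul1r.
  by apply: cvg_geometric; rewrite ger0_norm// invf_lt1// ltr1n.
have ltc c : 0 < c -> \forall m \near \oo, 2^-1 ^+ m < c :> R.
  move=> c0; have /cvgrPdist_lt/(_ c c0) := half0.
  by apply: filterS => m; rewrite sub0r normrN ger0_norm// exprn_ge0.
(* One cover of large index m suffices: m >= M, m > k so that the fast exponent is in force, m s >=
   1, and 2^-m below both delta and eps. *)
near \oo => m.
have Mm : (M <= m)%N by near: m; exact: nbhs_infty_ge.
have km : (k < m)%N by near: m; exact: nbhs_infty_ge.
have ms : 1 <= m%:R * s by rewrite -ler_pdivrMr// mul1r; near: m; exact: nbhs_infty_ger.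
have he := admissible_truncated k.
apply: (@le_trans _ _ ((size (large_digit_cover (R := R) (truncated_exponent k) m (4 ^ m)))%:R *
    (endpoint (truncated_exponent k) m) `^ s)%:E).
  apply: hausdorff_premeasure_seq_cover => //.
  - exact/ltW/endpoint_gt0.
  - apply: (le_trans (endpoint_le_exp he m)); apply: ltW; near: m; exact: ltc.
  - by move=> x; apply.
  - by move=> p /(large_digit_cover_len he)[].
rewrite lee_fin.
apply: (@le_trans _ _ (2^-1 ^+ m)); last by apply: ltW; near: m; exact: ltc.
apply: le_trans (fast_cover_sum s0 ms).
rewrite /endpoint /truncated_exponent leqNgt km /= -/(truncated_exponent k).
by apply: ler_wpM2r; rewrite ?powR_ge0// ler_nat (large_digit_cover_size (R := R)).
Unshelve. all: by end_near. Qed.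

Definition small_digits (m : nat) : set (measurableTypeR R) :=
  seq_cover (small_digit_cover id m (4 ^ m)).

Lemma lebesgue_measure_small_digits m :
  (lebesgue_measure (small_digits m) <= (2^-1 ^+ m)%:E)%E.
Proof.
apply: le_trans (lebesgue_measure_seq_cover _) _.
  exact: (small_digit_cover_le admissible_id).
by rewrite (small_digit_cover_sum admissible_id) lee_fin no_large_digit_measure.
Qed.

Lemma lebesgue_measure_lim_sup_small_digits :
  lebesgue_measure (lim_sup_set small_digits) = 0%E.
Proof.
apply: lim_sup_set_cvg0 => [m|]; first exact: seq_cover_measurable.
apply: (@le_lt_trans _ _ 2%:E); last exact: ltry.
(* Borel-Cantelli: the measures are at most 2^-m = 2 / 2^(m+1), with sum at most 2. *)
apply: le_trans (epsilon_trick0 xpredT (ler0n _ 2)).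
apply: lee_nneseries => // m _; apply: (le_trans (lebesgue_measure_small_digits m)).
by rewrite lee_fin natrX exprS invfM mulrA divff// mul1r exprVn.
Qed.

(** The image under theta is the preimage under its continuous inverse. *)
Lemma homeo_image_measurable (theta : R -> R) (A : set (measurableTypeR R)) :
  increasing_homeo01 theta -> measurable A ->
  measurable (theta @` (A `&` `[0, 1]) : set (measurableTypeR R)).
Proof.
move=> [_ t01 _ [g [g01 gc tK gK]]] mA.
have -> : theta @` (A `&` `[0, 1]) = `[0, 1] `&` g @^-1` A.
  apply/seteqP; split => [_ [x [Ax x01] <-]|y [y01 Ay]].
    by split; [exact: t01|rewrite /preimage /= tK].
  by exists (g y); [split => //; exact: g01|exact: gK].
exact: (subspace_continuous_measurable_fun (measurable_itv _) gc).
Qed.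

(** If no set [large_digits_from k M] had positive measure, [0, 1] would be a countable union of
    [mu]-null sets: their images under theta, the point 0, which has no coding, and the limsup set
    of [small_digits]. This contradicts mass 1. *)
Lemma dim_conjugate_acip0 k (mu : probability (measurableTypeR R) R) theta :
  acip (linear_map id) mu ->
  conjugacy (branch (truncated_exponent k)) (linear_map (truncated_exponent k))
    (branch id) (linear_map id) theta ->
  hausdorff_dim_measure (comp_measure01 mu theta) = 0%E.
Proof.
move=> [mu01 muL _] [homeo _ thetaC].
have he := admissible_truncated k.
apply/eqP; rewrite eq_le; apply/andP; split; last first.
  by apply: le_ereal_inf_tmp => _ [A _ <-]; exact: hausdorff_dim_ge0.
suff [M muM] : exists M, (0 < comp_measure01 mu theta (large_digits_from k M))%E.
  apply: ge_ereal_inf; exists (hausdorff_dim (large_digits_from k M)).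
    by exists (large_digits_from k M) => //; split => //; exact: large_digits_from_measurable.
  by rewrite hausdorff_dim_large_digits_from.
apply: contrapT => /forallNP muM.
pose D M : set (measurableTypeR R) := theta @` (large_digits_from k M `&` `[0, 1]).
have mD M : measurable (D M).
  exact: homeo_image_measurable (large_digits_from_measurable k M).
have D0 M : mu.-negligible (D M).
  apply/negligibleP => //; apply/eqP; rewrite eq_le measure_ge0 andbT leNgt.
  exact/negP/muM.
have mS : measurable (lim_sup_set small_digits).
  apply: bigcapT_measurable => n; apply: bigcup_measurable => m _.
  exact: seq_cover_measurable.
have S0 : mu.-negligible ([set 0] `|` lim_sup_set small_digits).
  apply/negligibleP; first exact: measurableU.
  move/null_content_dominatesP : muL; apply; first exact: measurableU.
  rewrite /= setUC measureU0//; first exact: lebesgue_measure_lim_sup_small_digits.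
  exact: lebesgue_measure_set1.
have : mu.-negligible `[0%R, 1%R]%classic.
  apply: negligibleS (negligibleU (negligible_bigcup D0) S0) => x x01.
  have [->|[s xs]] := coding_cases admissible_id x01; first by right; left.
  (* If x is in no [D M], then for each M some m >= M has all of the first 4^m digits of x below m,
     which puts x in [small_digits m]. Theta preserves digits, so they are the same for both
     maps. *)
  have [[M DM]|/forallNP nD] := pselect (exists M, D M x); first by left; exists M.
  right; right => M _; apply: contrapT => nW; apply: (nD M).
  exists (coding (branch (truncated_exponent k)) s); last by rewrite thetaC.
  split; last by rewrite /= in_itv /= coding_itv01.
  move=> m /= Mm; apply: contrapT => nV; apply: nW; exists m => //.
  rewrite -xs; apply: (small_digit_coverP admissible_id) => j jm.
  rewrite ltnNge; apply/negP => mj; apply: nV.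
  by apply: (large_digit_coverP he); exists j.
move/negligibleP => /(_ (measurable_itv _)); rewrite /= mu01 => /eqP.
by rewrite onee_eq0.
Qed.

End DimensionDrop.

(** * Summability of the branch lengths of T to the power 1/2, and the final assembly *)

Lemma sum_len_half_lty {R : realType} :
  (\sum_(i <oo) lebesgue_measure (@branch R id i @` `[0%R, 1%R]) `^ (1 / 2) < +oo)%E.
Proof.
have imE i : (@branch R id i @` `[0%R, 1%R]) = `[endpoint id i.+1, endpoint id i]%classic.
  apply/seteqP; split => [_ [x + <-]|x]; rewrite /= !in_itv /= => /andP[x0 x1].
    by rewrite (branch_ge admissible_id)// (branch_le admissible_id).
  exists ((x - endpoint id i.+1) / len id i); last exact: (branchVK admissible_id).
  rewrite /= in_itv /= -(branch_ler admissible_id i) -(branch_ler admissible_id i _ 1).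
  by rewrite (branchVK admissible_id) branch0 branch1 x0.
(* Branch i has length 2^-(i+1), whose square root is c^(i+1). *)
pose c : R := 2^-1 `^ (1 / 2).
have c0 : 0 < c by rewrite powR_gt0// invr_gt0.
have c1 : c < 1.
  have cc : c ^+ 2 = 2^-1.
    by rewrite expr2 -powRD ?invr_eq0 ?pnatr_eq0 ?implybT// -splitr powRr1 ?invr_ge0.
  by rewrite -(ltr_pXn2r (n := 2)) ?nnegrE ?ler01 ?(ltW c0)// cc expr1n invf_lt1// ltr1n.
have termE i : (lebesgue_measure (@branch R id i @` `[0%R, 1%R]) `^ (1 / 2) =
    (geometric c c i)%:E)%E.
  rewrite imE lebesgue_measure_itv /= lte_fin.
  rewrite (endpoint_ltr admissible_id)// -EFinD poweR_EFin; congr _%:E.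
  have -> : endpoint id i - endpoint id i.+1 = 2^-1 ^+ i.+1 :> R.
    by rewrite /endpoint exprS; lra.
  by rewrite -powR_mulrn ?invr_ge0// powRAC powR_mulrn ?ltW// exprS.
rewrite (eq_eseriesr (fun i _ => termE i)).
have cv : cvgn (series (geometric c c)) by apply: is_cvg_geometric_series; rewrite gtr0_norm.
rewrite (_ : (\sum_(i <oo) (geometric c c i)%:E)%E = (limn (series (geometric c c)))%:E) ?ltry//.
rewrite -EFin_lim//; apply: congr_lim; apply/funext => n.
by rewrite /= /series /= sumEFin.
Qed.

Theorem proposition1p4 (R : realType) :
  exists (o : orientation) (f : nat -> R -> R) (T : R -> R)
         (fk : nat -> nat -> R -> R) (Tk : nat -> R -> R),
    (countable_markov_map o f T /\ finite_potential f) /\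
    (forall k, countable_markov_map o (fk k) (Tk k) /\
               finite_potential (fk k)) /\
    summable_variations (potential f) /\
    (exists t : R, 0 < t < 1 /\
      (\sum_(i <oo) lebesgue_measure (f i @` `[0%R, 1%R]) `^ t < +oo)%E) /\
    (ereal_sup (range (fun k => sum_variations (potential (fk k)))) < +oo)%E /\
    (forall i (x : R), x \in `[0, 1] -> fk k i x @[k --> \oo] --> f i x) /\
    (exists mu, acip T mu) /\
    (forall k, exists theta, conjugacy (fk k) (Tk k) f T theta) /\
    (forall mu (theta : nat -> R -> R), acip T mu ->
      (forall k, conjugacy (fk k) (Tk k) f T (theta k)) ->
      hausdorff_dim_measure (comp_measure01 mu (theta k)) @[k --> \oo]
        --> (0 : \bar R)%E).
Proof.
have hid := admissible_id; have hk := admissible_truncated.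
exists Increasing, (branch id), (linear_map id),
  (fun k => branch (truncated_exponent k)), (fun k => linear_map (truncated_exponent k)).
split; first by split; [exact: linear_markov_map|exact: linear_finite_potential].
split; first by move=> k; split; [exact: linear_markov_map|exact: linear_finite_potential].
split; first by rewrite /summable_variations linear_sum_variations.
split; first by exists (1 / 2); split; [lra|exact: sum_len_half_lty].
split.
  apply: (@le_lt_trans _ _ 0%E) => //.
  by apply: ge_ereal_sup => _ [k _ <-]; rewrite linear_sum_variations.
split.
  move=> i x _; apply: cvg_near_cst; near=> k.
  (* For k > i the exponents at i and i + 1 are those of the identity, so branch i of [T_k] equals
     that of T. *)
  have ik : (i < k)%N by near: k; exact: nbhs_infty_gt.
  by rewrite /branch /len /endpoint /truncated_exponent ik ltnW.
split; first by exists unit_lebesgue; exact: linear_acip.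
split.
  by move=> k; exists (conj_map (truncated_exponent k) id); exact: linear_conjugacy.
move=> mu theta acipmu conj; apply: cvg_near_cst; apply: nearW => k.
exact: dim_conjugate_acip0 acipmu (conj k).
Unshelve. all: by end_near. Qed.
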